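(* Let $\mathcal M$ be a compact separable metric space with metric $\rho$ and nonnegative Borel measure $\mu$, $\mu(\mathcal M)=1$, let $\xi$ be a finite nonnegative measure on $T$, and let $\{V_i\}_{i=1}^N$ be an equal measure partition of $\mathcal M$. For $X_N=(x_1,\dots,x_N)\in\Omega_N$ define the random variables $$\rho^*_r[X_N]=\sum_{i\ne j}\rho^*_r(x_i,x_j),\quad \rho^*[\xi,X_N]=\sum_{i\ne j}\rho^*(\xi,x_i,x_j),$$ $$\lambda_r[X_N]=\sum_{i}\lambda_r(x_i,x_i)+\sum_{i\ne j}\lambda_r(x_i,x_j),\quad \lambda[\xi,X_N]=\sum_{i}\lambda(\xi,x_i,x_i)+\sum_{i\ne j}\lambda(\xi,x_i,x_j).$$ Then for each $r\in T$, $$2\,\mathbb E_N\lambda_r+\mathbb E_N\rho^*_r=N^2\langle\rho^*_r\rangle,\qquad 2\,\mathbb E_N\lambda[\xi,\cdot\,]+\mathbb E_N\rho^*[\xi,\cdot\,]=N^2\langle\rho^*(\xi)\rangle.$$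
   Context: $B_r(y)=\{x:\rho(x,y)\le r\}$; $T=\{\rho(y_1,y_2):y_1,y_2\in\mathcal M\}$. $\chi(E,x)$ is the indicator of $x\in E$. $\Lambda(B_r(y),x)=\chi(B_r(y),x)-\mu(B_r(y))$; $\lambda_r(y_1,y_2)=\int_{\mathcal M}\Lambda(B_r(y),y_1)\Lambda(B_r(y),y_2)\,d\mu(y)$; $\lambda(\xi,y_1,y_2)=\int_T\lambda_r(y_1,y_2)\,d\xi(r)$. $\rho^*_r(y_1,y_2)=\mu(B_r(y_1)\,\Delta\,B_r(y_2))$; $\rho^*(\xi,y_1,y_2)=\int_T\rho^*_r(y_1,y_2)\,d\xi(r)$; $\langle\rho^*_r\rangle=\iint_{\mathcal M\times\mathcal M}\rho^*_r(y_1,y_2)\,d\mu(y_1)d\mu(y_2)$; $\langle\rho^*(\xi)\rangle=\int_T\langle\rho^*_r\rangle\,d\xi(r)$. An equal measure partition is a family of measurable $V_1,\dots,V_N$ with $\mu(\mathcal M\setminus\bigcup V_i)=0$, $\mu(V_i\cap V_j)=0$ ($i\ne j$), $\mu(V_i)=1/N$. $\Omega_N=V_1\times\dots\times V_N$ carries the probability measure $\prod_iN\mu|_{V_i}$, and $\mathbb E_N$ is the expectation with respect to it. *)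

(* Defs.v *)
From HB Require Import structures.
From mathcomp Require Import all_boot all_order all_algebra.
From mathcomp Require Import all_classical all_reals all_analysis.

Set Implicit Arguments.
Unset Strict Implicit.
Unset Printing Implicit Defensive.

Import Order.TTheory GRing.Theory Num.Theory.
Import numFieldNormedType.Exports.

Local Open Scope classical_set_scope.
Local Open Scope ring_scope.

(* The two structures are a priori unrelated; that the sigma-algebra is the
   Borel one is the separate predicate [borel_space] below. *)
#[short(type="measurableMetricType")]
HB.structure Definition MeasurableMetric (R : numDomainType)
  (d : measure_display) := {M of Metric R M & Measurable d M}.

Definition borel_space (R : realType) (d : measure_display)
    (M : measurableMetricType R d) : Prop :=
  (@measurable d M : set (set M)) = <<s (open : set (set M)) >>.

Definition separable_space (T : topologicalType) : Prop :=
  exists2 D : set T, countable D & dense D.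

Section discrepancy.
Context {R : realType} {d : measure_display} {M : measurableMetricType R d}.
Variable mu : probability M R.
Variable xi : {finite_measure set R -> \bar R}.
Local Open Scope ereal_scope.

(* In a metric space this can be larger than the library's [closed_ball],
   which is the closure of the open ball. *)
Definition cball (y : M) (r : R) : set M := [set x | (mdist x y <= r)%R].

Definition radii : set R :=
  [set mdist p.1 p.2 | p in [set: M * M]].

Definition Lambda (E : set M) (x : M) : R := (\1_E x - fine (mu E))%R.

Definition lambda_r (r : R) (y1 y2 : M) : \bar R :=
  \int[mu]_y (Lambda (cball y r) y1 * Lambda (cball y r) y2)%:E.

(* A finite measure on [radii] is represented by a finite Borel measure on R,
   of which only the restriction to [radii] matters. *)
Definition lambda (y1 y2 : M) : \bar R :=
  \int[xi]_(r in radii) lambda_r r y1 y2.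

Definition rhostar_r (r : R) (y1 y2 : M) : \bar R :=
  mu (cball y1 r `+` cball y2 r).

Definition rhostar (y1 y2 : M) : \bar R :=
  \int[xi]_(r in radii) rhostar_r r y1 y2.

Definition mean_rhostar_r (r : R) : \bar R :=
  \int[mu \x mu]_p rhostar_r r p.1 p.2.

Definition mean_rhostar : \bar R :=
  \int[xi]_(r in radii) mean_rhostar_r r.

End discrepancy.

(* [rhostar_sum] and [lambda_sum] turn a kernel into the random variable on
   N-point configurations: off-diagonal sum, resp. diagonal plus off-diagonal
   sum. *)
Section pair_sums.
Context {R : realType} {M : Type} {N : nat}.
Local Open Scope ereal_scope.

Definition rhostar_sum (k : M -> M -> \bar R) (X : N.-tuple M) : \bar R :=
  \sum_(p : 'I_N * 'I_N | p.1 != p.2) k (tnth X p.1) (tnth X p.2).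

Definition lambda_sum (k : M -> M -> \bar R) (X : N.-tuple M) : \bar R :=
  \sum_(i < N) k (tnth X i) (tnth X i) +
  \sum_(p : 'I_N * 'I_N | p.1 != p.2) k (tnth X p.1) (tnth X p.2).

End pair_sums.

Section tuple_probability.
Context {R : realType} {d : measure_display} {M : measurableType d}.

Definition tuple_cons (n : nat) (p : M * n.-tuple M) : n.+1.-tuple M :=
  [tuple of p.1 :: p.2].

Lemma measurable_tuple_cons (n : nat) :
  measurable_fun [set: M * n.-tuple M] (@tuple_cons n).
Proof. exact: measurable_cons. Qed.

HB.instance Definition _ (n : nat) :=
  isMeasurableFun.Build _ _ _ _ (@tuple_cons n) (@measurable_tuple_cons n).

(* The product of P_0, ..., P_(n-1) on n-tuples, by transporting the binary
   product P_0 x (P_1 x ... x P_(n-1)) along (x, X) |-> x :: X. *)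
Fixpoint tuple_probability (n : nat) :
    ('I_n -> probability M R) -> probability (n.-tuple M) R :=
  match n with
  | 0 => fun _ => \d_([tuple] : 0.-tuple M)
  | n'.+1 => fun P =>
      distribution (P ord0 \x tuple_probability (fun i => P (lift ord0 i)))%E
        (@tuple_cons n')
  end.

Lemma tuple_probability_box (n : nat) (P : 'I_n -> probability M R)
    (A : 'I_n -> set M) : (forall i, measurable (A i)) ->
  tuple_probability P [set X | forall i, A i (tnth X i)] =
  (\prod_(i < n) P i (A i))%E.
Proof.
elim: n P A => [|n IH] P A mA.
  by rewrite big_ord0 /= diracE mem_set//=; case.
rewrite big_ord_recl /= /distribution /pushforward /=.
rewrite -IH; last by move=> i; exact: mA.
rewrite -product_measure1E//; last first.
  rewrite [X in measurable X](_ : _ = \big[setI/setT]_(i < n)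
      ((fun X : n.-tuple M => tnth X i) @^-1` A (lift ord0 i))).
    apply: bigsetI_measurable => i _; rewrite -[X in measurable X]setTI.
    exact: (measurable_tnth i).
  apply/seteqP; split => X /=.
    by move=> h; rewrite -bigcap_seq => i _; exact: h.
  by rewrite -bigcap_seq => h i; apply: (h i); rewrite /= mem_index_enum.
congr ((_ \x _)%E _); apply/seteqP; split => -[x X] /=.
  move=> h; split; first exact: (h ord0).
  by move=> i; have := h (lift ord0 i); rewrite tnthS.
by move=> [Ax h] i; case: (unliftP ord0 i) => [j|] ->; rewrite ?tnthS.
Qed.

End tuple_probability.

Record equal_measure_partition (R : realType) (d : measure_display)
    (M : measurableType d) (mu : probability M R) (N : nat) :=
  EqualMeasurePartition {
    cell :> 'I_N -> set M;
    measurable_cell : forall i, measurable (cell i);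
    cell_cover : mu (~` \bigcup_i cell i) = 0%E;
    cell_disjoint : forall i j, i != j -> mu (cell i `&` cell j) = 0%E;
    cell_mass : forall i, mu (cell i) = (N%:R^-1)%:E
  }.

Section expectation.
Context {R : realType} {d : measure_display} {M : measurableType d}.
Context {mu : probability M R} {N : nat}.
Variable V : equal_measure_partition mu N.
Local Open Scope ereal_scope.

Definition cell_probability (i : 'I_N) : set M -> \bar R :=
  mscale (N%:R%:nng)%R (mrestr mu (measurable_cell V i)).

HB.instance Definition _ (i : 'I_N) := Measure.on (cell_probability i).

Lemma cell_probability_setT (i : 'I_N) : cell_probability i setT = 1.
Proof.
rewrite /cell_probability /mscale /= /mrestr setTI cell_mass -EFinM mulfV//.
by rewrite pnatr_eq0 -lt0n (leq_ltn_trans _ (ltn_ord i)).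
Qed.

HB.instance Definition _ (i : 'I_N) :=
  Measure_isProbability.Build _ _ _ (cell_probability i)
    (cell_probability_setT i).

Definition Omega : set (N.-tuple M) := [set X | forall i, V i (tnth X i)].

(* The product of the N mu|V_i, as a measure on all N-tuples, gives full mass
   to [Omega]. *)
Definition partition_expectation (F : N.-tuple M -> \bar R) : \bar R :=
  \int[tuple_probability (fun i => cell_probability i)]_(X in Omega) F X.

End expectation.

(* Main.v *)
(** Write [L(x, y)] for [lambda_r] and [a = Lambda (B_r(z)) x],
    [b = Lambda (B_r(z)) y].  As [z] lies in [B_r(x)] iff [x] lies in [B_r(z)],
    [(a - b)^2] is the indicator of [z] in the symmetric difference of [B_r(x)]
    and [B_r(y)]; integrating over [z] gives
    [rhostar(x, y) = L(x, x) + L(y, y) - 2 L(x, y)], and the same identity holds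
    after integration in [r].  Summed over pairs it turns
    [2 lambda[X] + rhostar[X]] into [2 N \sum_i L(x_i, x_i)] for every
    configuration [X].  The mean of that sum is [N \int L(x, x)], because the
    normalized cells average to [mu]; and since [\int L(x, y) dy = 0], the
    identity also gives [<rhostar> = 2 \int L(x, x)]. *)

Require Import Defs.
From HB Require Import structures.
From mathcomp Require Import all_boot all_order all_algebra.
From mathcomp Require Import all_classical all_reals all_analysis.
From mathcomp Require Import measurable_realfun ring lra.
Import Order.TTheory GRing.Theory Num.Theory.
Import numFieldNormedType.Exports.

Local Open Scope classical_set_scope.
Local Open Scope ring_scope.
Local Open Scope ereal_scope.

(** * Measurability of the distance, of balls and of the set of radii *)

Section metric_measurability.
Context {R : realType} {d : measure_display} {M : measurableMetricType R d}.
Local Open Scope ring_scope.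

Lemma mdist_continuous : continuous (fun p : M * M => mdist p.1 p.2).
Proof.
move=> [a b]; apply/cvgrPdist_lt => /= e e0; near=> p.
have ha : mdist a p.1 < e / 2.
  have : ball a (e / 2) p.1.
    near: p; apply: (@cvg_fst _ _ (nbhs a) (nbhs b)).
    by apply: nbhsx_ballx; rewrite divr_gt0.
  by rewrite ballEmdist.
have hb : mdist b p.2 < e / 2.
  have : ball b (e / 2) p.2.
    near: p; apply: (@cvg_snd _ _ (nbhs a) (nbhs b)).
    by apply: nbhsx_ballx; rewrite divr_gt0.
  by rewrite ballEmdist.
have h1 := metric_triangle a p.1 b.
have h2 := metric_triangle p.1 p.2 b.
have h3 := metric_triangle p.1 a p.2.
have h4 := metric_triangle a b p.2.
move: h2 h3; rewrite (metric_sym p.2 b) (metric_sym p.1 a) => h2 h3.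
by rewrite ltr_norml; apply/andP; split; lra.
Unshelve. all: by end_near. Qed.

(** [radii] is the image of the compact space [M * M] under the continuous distance, hence compact,
    and so closed in the real line. *)
Lemma radii_measurable : compact [set: M] -> measurable (radii (M := M)).
Proof.
move=> cM; apply: closed_measurable.
apply: compact_closed; first exact: norm_hausdorff.
apply: continuous_compact; last by rewrite -setXTT; exact: compact_setX.
by apply: continuous_subspaceT; exact: mdist_continuous.
Qed.

Hypothesis separableM : separable_space M.
Hypothesis borelM : borel_space M.

Lemma ball_measurable (x : M) (e : R) : measurable (ball x e).
Proof.
have [e0|e0] := ltP 0 e; last first.
  rewrite (_ : ball x e = set0) // -subset0 => y; rewrite ballEmdist /=.
  by rewrite ltNge (le_trans e0 (mdist_ge0 _ _)).
rewrite borelM; apply: sub_sigma_algebra; rewrite /= openE => y /=.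
rewrite ballEmdist /= => xy.
apply/nbhs_ballP; exists (e - mdist x y) => /=; first by rewrite subr_gt0.
move=> z; rewrite !ballEmdist /= => yz.
by have := metric_triangle x y z; lra.
Qed.

(* Separability makes the product sigma-algebra rich enough: [mdist x y < r]
   is witnessed by a point of a countable dense set and a rational radius. *)
Lemma measurable_mdist :
  measurable_fun [set: M * M] (fun p : M * M => mdist p.1 p.2).
Proof.
have [D cD dD] := separableM.
apply: (measurability _ (RGenInftyO.measurableE R)) => //.
move=> _ [_ [r ->] <-]; rewrite setTI.
rewrite [X in measurable X](_ : _ = \bigcup_(z in D) \bigcup_(q : rat)
    (ball z (ratr q : R) `*` ball z (r - ratr q))).
  rewrite bigcup_set_type; apply: countable_bigcupT_measurable => [|z].
    by rewrite (eq_countable (card_setT _)).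
  apply: bigcupT_measurable_rat => q.
  by apply: measurableX; exact: ball_measurable.
apply/seteqP; split => -[x y] /=; last first.
  move=> [z _ [q _]] [] /=; rewrite !ballEmdist /= in_itv /= => xz yz.
  have := metric_triangle x z y; rewrite (metric_sym x z); lra.
rewrite in_itv /= => xy.
(* Half of the gap suffices: if [mdist x z < q < e], then [mdist z y < e + mdist x y = r - e < r -
   q]. *)
pose e := (r - mdist x y) / 2.
have e0 : 0 < e by rewrite divr_gt0 // subr_gt0.
have [z [xz Dz]] : (ball x e)° `&` D !=set0.
  apply: dD; last exact: open_interior.
  by exists x; exact: nbhsx_ballx.
have {}xz : mdist x z < e.
  by have := interior_subset xz; rewrite ballEmdist.
have [q] := rat_in_itvoo xz; rewrite in_itv /= => /andP[q1 q2].
exists z => //; exists q => //; split; rewrite /= !ballEmdist /=.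
  by rewrite metric_sym.
have := metric_triangle z x y; rewrite (metric_sym z x).
rewrite /e in xz q2; lra.
Qed.

End metric_measurability.

(** * Integrals of bounded functions, and integrals depending on a parameter *)

Section bounded_integrands.
Context {d : measure_display} {T : measurableType d} {R : realType}.
Variable m : {finite_measure set T -> \bar R}.

Lemma integrable_le_cst (D : set T) (f : T -> \bar R) (C : R) :
  measurable D -> measurable_fun D f ->
  (forall x, D x -> `|f x| <= C%:E) -> m.-integrable D f.
Proof.
move=> mD mf fC.
apply: (le_integrable mD mf _ (finite_measure_integrable_cst m C mD)).
move=> x Dx /=; rewrite (le_trans (fC x Dx)) // lee_fin; exact: ler_norm.
Qed.

Lemma abse_integral_le_cst (D : set T) (f : T -> \bar R) (C : R) :
  measurable D -> measurable_fun D f ->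
  (forall x, D x -> `|f x| <= C%:E) -> `|\int[m]_(x in D) f x| <= C%:E * m D.
Proof.
move=> mD mf fC; apply: (le_trans (le_abse_integral _ mD mf)).
rewrite -integral_cst //; apply: ge0_le_integral => //.
exact: measurableT_comp.
Qed.

End bounded_integrands.

(** Tonelli makes the integrals of [f^\+] and [f^\-] measurable in [x], and the integral of [f] is
    their difference. The signed form serves [lambda_r], whose integrand changes sign. *)
Lemma measurable_parameter_integral {d1 d2 : measure_display}
    {T1 : measurableType d1} {T2 : measurableType d2} {R : realType}
    (m : {sigma_finite_measure set T2 -> \bar R}) (f : T1 * T2 -> \bar R) :
  measurable_fun setT f ->
  measurable_fun setT (fun x => \int[m]_y f (x, y)).
Proof.
move=> mf; under eq_fun => x do rewrite integralE.
apply: emeasurable_funB.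
- rewrite [X in measurable_fun _ X](_ : _ = fubini_F m f^\+); last first.
    by apply/funext => x; apply: eq_integral => y _; rewrite !funeposE.
  apply: measurable_fun_fubini_tonelli_F => //.
  exact: measurable_funepos.
- rewrite [X in measurable_fun _ X](_ : _ = fubini_F m f^\-); last first.
    by apply/funext => x; apply: eq_integral => y _; rewrite !funenegE.
  apply: measurable_fun_fubini_tonelli_F => //.
  exact: measurable_funeneg.
Qed.

(** * Joint measurability of the kernels, and their identities at a fixed radius *)

Section discrepancy_kernel.
Context {R : realType} {d : measure_display} {M : measurableMetricType R d}.
Hypothesis separableM : separable_space M.
Hypothesis borelM : borel_space M.
Variable mu : probability M R.

(** Membership in the ball says that radius minus distance is nonnegative, a measurable condition on
    radius, centre and point together. Sections of this graph yield the measurability of each ball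
    and of its mass. *)
Lemma measurable_cball_graph :
  measurable [set p : (R * M) * M | cball p.1.2 p.1.1 p.2].
Proof.
pose h (p : (R * M) * M) : R := (p.1.1 - mdist p.2 p.1.2)%R.
have mh : measurable_fun setT h.
  apply: measurable_funB.
    exact: (measurableT_comp measurable_fst measurable_fst).
  have mg : measurable_fun setT (fun p : (R * M) * M => (p.2, p.1.2)).
    apply: measurable_fun_pair => //=.
    exact: (measurableT_comp measurable_snd measurable_fst).
  exact: (measurableT_comp (measurable_mdist separableM borelM) mg).
rewrite (_ : [set _ | _] = setT `&` h @^-1` `[0%R, +oo[%classic).
  by apply: mh => //; exact: measurable_itv.
by rewrite setTI; apply/seteqP; split => p /=; rewrite in_itv /= andbT subr_ge0.
Qed.

Lemma cball_measurable (y : M) (r : R) : measurable (cball y r).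
Proof.
rewrite (_ : cball y r =
    xsection [set p : (R * M) * M | cball p.1.2 p.1.1 p.2] (r, y)).
  exact: measurable_xsection measurable_cball_graph.
by apply/seteqP; split => x; rewrite /xsection /= inE.
Qed.

Lemma measurable_Lambda : measurable_fun setT
  (fun p : (R * M) * M => Lambda mu (cball p.1.2 p.1.1) p.2).
Proof.
apply: measurable_funB.
  rewrite (_ : (fun x => _) = \1_[set p : (R * M) * M | cball p.1.2 p.1.1 p.2]).
    exact: measurable_indic measurable_cball_graph.
  by apply/funext => -[[r y] x]; rewrite !indicE; congr ((_ : bool)%:R);
    apply/idP/idP; rewrite !inE.
apply: (measurableT_comp (f := fine)) => //.
apply: (measurableT_comp (f := fun q : R * M => mu (cball q.2 q.1))) => //.
rewrite (_ : (fun q => _) = mu \o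
    xsection [set p : (R * M) * M | cball p.1.2 p.1.1 p.2]).
  exact: measurable_fun_xsection measurable_cball_graph.
apply/funext => -[r y] /=; congr (mu _).
by apply/seteqP; split => x; rewrite /xsection /= inE.
Qed.

Lemma Lambda_le1 (E : set M) (x : M) :
  measurable E -> (`|Lambda mu E x| <= 1)%R.
Proof.
move=> mE; have h0 : (0 <= fine (mu E))%R by apply: fine_ge0.
have h1 : (fine (mu E) <= 1)%R.
  by rewrite -lee_fin fineK ?fin_num_measure // probability_le1.
rewrite /Lambda indicE ler_norml.
by case: (x \in E); rewrite /=; apply/andP; split; lra.
Qed.

(* The integrand of [lambda_r], jointly in the radius, the pair of points and
   the centre. *)
Let Lambda2 (p : (R * (M * M)) * M) : R :=
  (Lambda mu (cball p.2 p.1.1) p.1.2.1 * Lambda mu (cball p.2 p.1.1) p.1.2.2)%R.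

Let measurable_Lambda2 : measurable_fun setT Lambda2.
Proof.
apply: measurable_funM.
- have mg : measurable_fun setT
      (fun p : (R * (M * M)) * M => ((p.1.1, p.2), p.1.2.1)).
    apply: measurable_fun_pair => /=.
      apply: measurable_fun_pair => //=.
      exact: (measurableT_comp measurable_fst measurable_fst).
    apply: (measurableT_comp measurable_fst).
    exact: (measurableT_comp measurable_snd measurable_fst).
  exact: (measurableT_comp measurable_Lambda mg).
- have mg : measurable_fun setT
      (fun p : (R * (M * M)) * M => ((p.1.1, p.2), p.1.2.2)).
    apply: measurable_fun_pair => /=.
      apply: measurable_fun_pair => //=.
      exact: (measurableT_comp measurable_fst measurable_fst).
    apply: (measurableT_comp measurable_snd).
    exact: (measurableT_comp measurable_snd measurable_fst).
  exact: (measurableT_comp measurable_Lambda mg).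
Qed.

Let Lambda2_le1 p : (`|Lambda2 p| <= 1)%R.
Proof.
rewrite normrM -[leRHS]mulr1.
by apply: ler_pM => //; apply: Lambda_le1; exact: cball_measurable.
Qed.

(** Measurability is joint because the kernel is integrated over points at a fixed radius and over
    radii at fixed points. *)
Lemma measurable_lambda_r : measurable_fun setT
  (fun q : R * (M * M) => lambda_r mu q.1 q.2.1 q.2.2).
Proof.
apply: (measurable_parameter_integral mu (EFin \o Lambda2)).
exact: measurableT_comp.
Qed.

Let measurable_Lambda2_section q :
  measurable_fun setT (fun y => (Lambda2 (q, y))%:E).
Proof.
apply: measurableT_comp => //.
exact: (measurableT_comp measurable_Lambda2 (measurable_pair1 q)).
Qed.

Lemma abse_lambda_r_le1 (r : R) (x y : M) : `|lambda_r mu r x y| <= 1.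
Proof.
rewrite -[leRHS](_ : 1%:E * mu setT = _); last first.
  by rewrite probability_setT mule1.
apply: abse_integral_le_cst => // [|z _].
  exact: (measurable_Lambda2_section (r, (x, y))).
by rewrite lee_fin; exact: (Lambda2_le1 ((r, (x, y)), z)).
Qed.

Let integrable_Lambda2 q : mu.-integrable setT (fun y => (Lambda2 (q, y))%:E).
Proof.
by apply: (@integrable_le_cst _ _ _ _ _ _ 1%R) => // y _; rewrite lee_fin.
Qed.

Lemma lambda_r_ge0 (r : R) (x : M) : 0 <= lambda_r mu r x x.
Proof. by apply: integral_ge0 => y _; rewrite lee_fin -expr2 sqr_ge0. Qed.

Lemma cball_sym (x y : M) (r : R) : cball x r y = cball y r x.
Proof. by rewrite /cball /= metric_sym. Qed.

(* Integrates [(a - b)^2 = a^2 + b^2 - 2 a b]. *)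
Lemma rhostar_rE (r : R) (x y : M) :
  rhostar_r mu r x y =
  lambda_r mu r x x + lambda_r mu r y y - 2%:E * lambda_r mu r x y.
Proof.
have mE : measurable (cball x r `+` cball y r).
  by apply: measurableU; apply: measurableD; exact: cball_measurable.
rewrite /rhostar_r -[X in mu X]setIT -integral_indic // /lambda_r.
have iL a b := integrable_Lambda2 (r, (a, b)).
rewrite -integralZl; [|exact: measurableT|exact: (iL x y)].
rewrite -integralD; [|exact: measurableT|exact: (iL x x)|exact: (iL y y)].
rewrite -integralB; [|exact: measurableT| |]; last 2 first.
- by apply: integrableD => //; [exact: (iL x x)|exact: (iL y y)].
- by apply: integrableZl => //; exact: (iL x y).
apply: eq_integral => z _; rewrite -EFinM -!EFinD; congr EFin.
rewrite /Lambda !indicE /setY !in_setU !in_setD.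
have H w : (z \in cball w r) = (w \in cball z r).
  by apply/idP/idP; rewrite !inE cball_sym.
(* The centring constant [fine (mu (cball z r))] cancels in the square of the difference, so each of
   the four membership cases is a polynomial identity. *)
by rewrite !H; case: (x \in _); case: (y \in _) => /=; ring.
Qed.

Lemma integrable_Lambda (E : set M) : measurable E ->
  mu.-integrable setT (fun x => (Lambda mu E x)%:E).
Proof.
move=> mE; apply: (@integrable_le_cst _ _ _ _ _ _ 1%R) => // [|x _].
  by apply: measurableT_comp => //; apply: measurable_funB.
by rewrite lee_fin Lambda_le1.
Qed.

Lemma integral_Lambda (E : set M) : measurable E ->
  \int[mu]_x (Lambda mu E x)%:E = 0.
Proof.
move=> mE; rewrite /Lambda.
under eq_integral do rewrite EFinB.
rewrite integralB //; last 2 first.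
- exact: integrable_indic.
- exact: finite_measure_integrable_cst.
rewrite integral_indic // setIT integral_cst //.
rewrite [X in _ * X](probability_setT mu) mule1 fineK ?fin_num_measure //.
by apply: subee; rewrite fin_num_measure.
Qed.

(** After Fubini the integral over [y] is the inner one. For a fixed centre [z] the factor at [x]
    comes out, and the remaining centred indicator has mean zero. *)
Lemma integral_lambda_r (r : R) (x : M) : \int[mu]_y lambda_r mu r x y = 0.
Proof.
pose f (p : M * M) := (Lambda2 ((r, (x, p.1)), p.2))%:E.
have mf : measurable_fun setT f.
  apply: measurableT_comp => //.
  have mg : measurable_fun setT (fun p : M * M => ((r, (x, p.1)), p.2)).
    apply: measurable_fun_pair => //=; apply: measurable_fun_pair => //=.
    exact: measurable_fun_pair.
  exact: (measurableT_comp measurable_Lambda2 mg).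
have if_ : (mu \x mu).-integrable setT f.
  apply: (@integrable_le_cst _ _ _
    (mu \x mu : probability (M * M)%type R) _ _ 1%R) => // p _.
  by rewrite lee_fin; exact: Lambda2_le1.
transitivity (\int[mu]_y \int[mu]_z f (y, z)) => //.
rewrite (Fubini if_); apply: integral0_eq => z _.
rewrite /fubini_G /f /Lambda2 /=.
under eq_integral do rewrite EFinM.
rewrite integralZl //; last first.
  by apply: integrable_Lambda; exact: cball_measurable.
by rewrite integral_Lambda ?mule0 //; exact: cball_measurable.
Qed.

Let measurable_lambda_rr (r : R) :
  measurable_fun setT (fun p : M * M => lambda_r mu r p.1 p.2).
Proof. exact: (measurableT_comp measurable_lambda_r (measurable_pair1 r)). Qed.

Lemma mean_rhostar_rE (r : R) :
  mean_rhostar_r mu r = 2%:E * \int[mu]_x lambda_r mu r x x.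
Proof.
have ik (g : M * M -> M * M) : measurable_fun setT g ->
    (mu \x mu).-integrable setT (fun p => lambda_r mu r (g p).1 (g p).2).
  move=> mg; apply: (@integrable_le_cst _ _ _
    (mu \x mu : probability (M * M)%type R) _ _ 1%R) => // [|p _].
    exact: (measurableT_comp (measurable_lambda_rr r) mg).
  exact: abse_lambda_r_le1.
have i1 := ik (fun p => (p.1, p.1))
  (measurable_fun_pair measurable_fst measurable_fst).
have i2 := ik (fun p => (p.2, p.2))
  (measurable_fun_pair measurable_snd measurable_snd).
have i12 := ik id (@measurable_id _ _ setT).
rewrite /mean_rhostar_r; under eq_integral do rewrite rhostar_rE.
rewrite integralB //; [|exact: integrableD|exact: integrableZl].
rewrite integralD // integralZl //.
(* The order of integration is chosen separately for the two diagonal terms, so that in each the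
   inner integrand is constant. *)
rewrite -(integral12_prod_meas1 i1) -(integral21_prod_meas1 i2).
rewrite -(integral12_prod_meas1 i12) /fubini_F /fubini_G /=.
rewrite [X in _ - _ * X](_ : _ = 0) ?mule0 ?sube0; last first.
  by apply: integral0_eq => x _; exact: integral_lambda_r.
have c a : \int[mu]_x cst a x = a.
  by rewrite integral_cst // [X in _ * X](probability_setT mu) mule1.
have -> : \int[mu]_x \int[mu]_y lambda_r mu r x x =
    \int[mu]_x lambda_r mu r x x.
  by apply: eq_integral => x _; exact: c.
by rewrite (mule_natl _ 2) mule2n.
Qed.

(** * The kernels integrated over the radius *)

Hypothesis compactM : compact [set: M].
Variable xi : {finite_measure set R -> \bar R}.

Let mradii := radii_measurable compactM.

Let measurable_lambda_r_radius (x y : M) :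
  measurable_fun setT (fun r : R => lambda_r mu r x y).
Proof.
exact: (measurableT_comp measurable_lambda_r
  (measurable_fun_pair (@measurable_id _ _ setT)
    (measurable_cst (x, y)))).
Qed.

(** Moving the restriction to [radii] into the integrand allows the use of parameter integrals and
    Tonelli on full product spaces. *)
Let radii_indic (f : R -> \bar R) :
  \int[xi]_(r in radii (M := M)) f r =
  \int[xi]_r ((\1_(radii (M := M)) r)%:E * f r).
Proof.
rewrite integral_mkcond; apply: eq_integral => r _.
by rewrite patchE indicE; case: ifP => _; rewrite ?mul1e ?mul0e.
Qed.

Lemma measurable_lambda :
  measurable_fun setT (fun p : M * M => lambda mu xi p.1 p.2).
Proof.
rewrite /lambda; under eq_fun do rewrite radii_indic.
apply: (measurable_parameter_integral xi (fun q : (M * M) * R =>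
  (\1_(radii (M := M)) q.2)%:E * lambda_r mu q.2 q.1.1 q.1.2)).
apply: emeasurable_funM.
  apply: measurableT_comp => //.
  by apply: (measurableT_comp (measurable_indic mradii)).
exact: (measurableT_comp measurable_lambda_r
  (measurable_fun_pair measurable_snd measurable_fst)).
Qed.

Lemma abse_lambda_le (x y : M) :
  `|lambda mu xi x y| <= (fine (xi (radii (M := M))))%:E.
Proof.
rewrite fineK ?fin_num_measure // -[leRHS]mul1e.
apply: abse_integral_le_cst => // [|r _]; last exact: abse_lambda_r_le1.
exact: measurable_funTS.
Qed.

Lemma lambda_ge0 (x : M) : 0 <= lambda mu xi x x.
Proof. by apply: integral_ge0 => r _; exact: lambda_r_ge0. Qed.

Lemma rhostarE (x y : M) :
  rhostar mu xi x y =
  lambda mu xi x x + lambda mu xi y y - 2%:E * lambda mu xi x y.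
Proof.
have iL a b : xi.-integrable (radii (M := M)) (fun r => lambda_r mu r a b).
  apply: (@integrable_le_cst _ _ _ xi _ _ 1%R) => // [|r _].
    exact: measurable_funTS.
  exact: abse_lambda_r_le1.
rewrite /rhostar /lambda.
rewrite -integralZl // -integralD // -integralB //; last 2 first.
- exact: integrableD.
- exact: integrableZl.
by apply: eq_integral => r _; exact: rhostar_rE.
Qed.

(** The fixed-radius formula is integrated over the radius. The diagonal [lambda_r mu r x x] is
    nonnegative, so Tonelli exchanges the integrals over [r] and [x]. *)
Lemma mean_rhostarE :
  mean_rhostar mu xi = 2%:E * \int[mu]_x lambda mu xi x x.
Proof.
have mL : measurable_fun setT (fun p : M * R => lambda_r mu p.2 p.1 p.1).
  exact: (measurableT_comp measurable_lambda_r
    (measurable_fun_pair measurable_snd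
      (measurable_fun_pair measurable_fst measurable_fst))).
rewrite /mean_rhostar; under eq_integral do rewrite mean_rhostar_rE.
rewrite ge0_integralZl //; last 2 first.
- apply: measurable_funTS.
  apply: (measurable_parameter_integral mu
    (fun q : R * M => lambda_r mu q.1 q.2 q.2)).
  exact: (measurableT_comp mL
    (measurable_fun_pair measurable_snd measurable_fst)).
- by move=> r _; apply: integral_ge0 => x _; exact: lambda_r_ge0.
congr (_ * _).
pose f (p : M * R) := (\1_(radii (M := M)) p.2)%:E * lambda_r mu p.2 p.1 p.1.
have mf : measurable_fun setT f.
  apply: emeasurable_funM => //; apply: measurableT_comp => //.
  by apply: (measurableT_comp (measurable_indic mradii)).
have f0 p : 0 <= f p.
  by apply: mule_ge0; [rewrite lee_fin indicE|exact: lambda_r_ge0].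
rewrite radii_indic.
transitivity (\int[xi]_r \int[mu]_x f (x, r)).
  apply: eq_integral => r _; rewrite /f /=.
  rewrite ge0_integralZl //; last by move=> x _; exact: lambda_r_ge0.
  exact: (measurableT_comp mL (measurable_pair2 r)).
rewrite -(@fubini_tonelli _ _ _ _ _ mu xi f mf f0).
by apply: eq_integral => x _; rewrite /lambda radii_indic.
Qed.

End discrepancy_kernel.

(** * Marginals of product probabilities and integrals against restricted measures *)

Section expectation.
Context {R : realType} {d : measure_display} {M : measurableType d}.

(** A cylinder is a box whose other sides are the whole space, each contributing a factor 1. *)
Lemma tuple_probability_marginal (n : nat) (P : 'I_n -> probability M R)
    (i : 'I_n) (A : set M) : measurable A ->
  tuple_probability P [set X | A (tnth X i)] = P i A.
Proof.
move=> mA; pose B j : set M := if j == i then A else setT.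
have mB j : measurable (B j) by rewrite /B; case: ifP.
rewrite (_ : [set X | _] = [set X | forall j, B j (tnth X j)]).
  rewrite tuple_probability_box // (bigD1 i) //= {1}/B eqxx big1 ?mule1 //.
  by move=> j /negbTE ji; rewrite /B ji probability_setT.
apply/seteqP; split => X /=; last by move=> /(_ i); rewrite /B eqxx.
by move=> AX j; rewrite /B; case: eqP => // ->.
Qed.

Lemma integral_tuple_marginal (n : nat) (P : 'I_n -> probability M R)
    (i : 'I_n) (g : M -> \bar R) :
  measurable_fun setT g -> (forall x, 0 <= g x) ->
  \int[tuple_probability P]_X g (tnth X i) = \int[P i]_x g x.
Proof.
move=> mg g0; have mi := @measurable_tnth _ M n i.
transitivity (\int[pushforward (tuple_probability P)
    (fun X : n.-tuple M => tnth X i)]_x g x).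
  by rewrite ge0_integral_pushforward.
apply: eq_measure_integral => A mA _.
exact: tuple_probability_marginal.
Qed.

(** The restricted measure does not charge the complement of [D], and agrees with [m] on measurable
    subsets of [D]. *)
Lemma ge0_integral_mrestr (m : {measure set M -> \bar R}) (D : set M)
    (mD : measurable D) (g : M -> \bar R) :
  measurable_fun setT g -> (forall x, 0 <= g x) ->
  \int[mrestr m mD]_x g x = \int[m]_(x in D) g x.
Proof.
move=> mg g0.
rewrite [LHS](@ge0_negligible_integral _ _ _ _ _ (~` D)) //; last 2 first.
- exact: measurableC.
- by rewrite -[LHS]/(m (~` D `&` D)) setICl measure0.
rewrite setTD setCK; apply: eq_measure_integral => A mA AD.
by rewrite -[LHS]/(m (A `&` D)) setIidl.
Qed.

(** * Expectation over one random point in each cell *)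

Context {mu : probability M R} {N : nat}.
Variable V : equal_measure_partition mu N.

(** Cells may overlap or miss points, but only on null sets, so their indicators add up to 1 almost
    everywhere. *)
Lemma sum_integral_cell (g : M -> \bar R) :
  measurable_fun setT g -> (forall x, 0 <= g x) ->
  \sum_(i < N) \int[mu]_(x in V i) g x = \int[mu]_x g x.
Proof.
move=> mg g0; have mV := measurable_cell V.
have m1 i : measurable_fun setT (fun x => (\1_(V i) x)%:E * g x).
  apply: emeasurable_funM => //; apply: measurableT_comp => //.
have g1 i x : 0 <= (\1_(V i) x)%:E * g x by apply: mule_ge0.
transitivity (\sum_(i < N) \int[mu]_x ((\1_(V i) x)%:E * g x)).
  apply: eq_bigr => i _; rewrite integral_mkcond; apply: eq_integral => x _.
  by rewrite patchE indicE; case: ifP => _; rewrite ?mul1e ?mul0e.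
rewrite -ge0_integral_sum //.
apply: ge0_ae_eq_integral => //.
- exact: emeasurable_sum.
- by move=> x _; apply: sume_ge0.
have H1 : {ae mu, forall x, exists i, V i x}.
  exists (~` \bigcup_i V i); split.
  - by apply: measurableC; exact: fin_bigcup_measurable.
  - exact: cell_cover.
  - by move=> x /= nV [i _ Vi]; apply: nV; exists i.
(* There are finitely many pairs, so the exceptional null sets can be treated one pair at a time;
   the claim is vacuous for equal indices. *)
have H2 : {ae mu, forall x, forall p : 'I_N * 'I_N,
    p.1 != p.2 -> ~ (V p.1 `&` V p.2) x}.
  apply: filter_forall => -[i j] /=; have [->|ij] := eqVneq i j.
    exact: filterE.
  exists (V i `&` V j); split; [exact: measurableI|exact: cell_disjoint|].
  by move=> x /=; apply: contra_notP => h _.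
apply: filterS2 H1 H2 => x [i Vi] disj _.
rewrite (bigD1 i) //= big1 ?adde0 ?indicE ?mem_set ?mul1e // => j ji.
by rewrite indicE memNset ?mul0e // => Vj; exact: (disj (j, i)).
Qed.

Let P := tuple_probability (fun i => cell_probability V i).

Lemma measurable_Omega : measurable (Omega V).
Proof.
rewrite [X in measurable X](_ : _ =
    \bigcap_(i in [set: 'I_N]) ((fun X : N.-tuple M => tnth X i) @^-1` V i)).
  apply: fin_bigcap_measurable => // i _; rewrite -[X in measurable X]setTI.
  exact: (measurable_tnth i measurableT (measurable_cell V i)).
by apply/seteqP; split => X /= h i; have := h i; [|apply].
Qed.

Lemma tuple_probability_Omega : P (Omega V) = 1.
Proof.
rewrite /P tuple_probability_box; last by move=> i; exact: measurable_cell.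
rewrite big1 // => i _.
rewrite -[LHS]/((N%:R)%:E * mu (V i `&` V i)) setIid cell_mass -EFinM mulfV //.
(* The existence of the index [i] forces [N] to be positive. *)
by rewrite pnatr_eq0 -lt0n (leq_ltn_trans _ (ltn_ord i)).
Qed.

Lemma ge0_integral_Omega (F : N.-tuple M -> \bar R) :
  measurable_fun setT F -> (forall X, 0 <= F X) ->
  \int[P]_(X in Omega V) F X = \int[P]_X F X.
Proof.
move=> mF F0; have mO := measurable_Omega.
rewrite [RHS](@ge0_negligible_integral _ _ _ _ _ (~` Omega V)) //.
- by rewrite setTD setCK.
- exact: measurableC.
- transitivity (1 - P (Omega V)); first exact: probability_setC.
  by rewrite tuple_probability_Omega subee.
Qed.

(** By linearity only the one-point marginals matter: the [i]-th contributes [N] times the integral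
    of [g] over [V i], and [sum_integral_cell] adds these up. *)
Lemma partition_expectation_sum (g : M -> \bar R) :
  measurable_fun setT g -> (forall x, 0 <= g x) ->
  partition_expectation V (fun X => \sum_(i < N) g (tnth X i)) =
  (N%:R)%:E * \int[mu]_x g x.
Proof.
move=> mg g0.
have mgi i : measurable_fun setT (fun X : N.-tuple M => g (tnth X i)).
  exact: (measurableT_comp mg (measurable_tnth i)).
rewrite /partition_expectation -/P ge0_integral_Omega //; last 2 first.
- exact: emeasurable_sum.
- by move=> X; exact: sume_ge0.
rewrite ge0_integral_sum // -sum_integral_cell // ge0_sume_distrr; last first.
  by move=> i _; exact: integral_ge0.
apply: eq_bigr => i _; rewrite /P integral_tuple_marginal //.
rewrite ge0_integral_mscale //; congr (_ * _).
exact: ge0_integral_mrestr.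
Qed.

(* Each [k x_i x_i] occurs in [2 N] of the terms on the right-hand side of
   [2 k x y + h x y = k x x + k y y]. *)
Lemma pair_sum_identity (k h : M -> M -> \bar R) (X : N.-tuple M) :
  (forall x y, k x y \is a fin_num) ->
  (forall x y, h x y = k x x + k y y - 2%:E * k x y) ->
  2%:E * lambda_sum k X + rhostar_sum h X =
  (2 * N%:R)%:E * \sum_(i < N) k (tnth X i) (tnth X i).
Proof.
(* Finiteness moves the identity into the real field, where subtraction cancels and [ring]
   applies. *)
move=> kfin hE; pose f i j : R := fine (k (tnth X i) (tnth X j)).
have kE i j : k (tnth X i) (tnth X j) = (f i j)%:E by rewrite fineK.
have -> : lambda_sum k X = (\sum_(i < N) f i i +
    \sum_(p : 'I_N * 'I_N | p.1 != p.2) f p.1 p.2)%:E.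
  by rewrite EFinD -!sumEFin; congr (_ + _); apply: eq_bigr.
have -> : rhostar_sum h X = (\sum_(p : 'I_N * 'I_N | p.1 != p.2)
    (f p.1 p.1 + f p.2 p.2 - 2 * f p.1 p.2))%:E.
  rewrite -sumEFin; apply: eq_bigr => p _.
  by rewrite hE !kE -EFinM -!EFinD.
have -> : \sum_(i < N) k (tnth X i) (tnth X i) = (\sum_(i < N) f i i)%:E.
  by rewrite -sumEFin; apply: eq_bigr.
rewrite -!EFinM -EFinD; congr EFin.
rewrite mulrDr -addrA [X in (_ + (X + _))%R]mulr_sumr -big_split /=.
under [X in (_ + X)%R]eq_bigr do rewrite addrC subrK.
(* The mixed terms are gone; rewritten over pairs of equal indices, the diagonal completes the
   off-diagonal sum to a sum over all pairs. *)
have -> : (2 * \sum_(i < N) f i i = \sum_(p : 'I_N * 'I_N | p.1 == p.2)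
    (f p.1 p.1 + f p.2 p.2))%R.
  rewrite -(pair_big_dep xpredT (fun i j => i == j)
    (fun i j => f i i + f j j)%R) /= mulr_sumr.
  apply: eq_bigr => i _.
  rewrite (eq_bigl (pred1 i)) ?big_pred1_eq; first by ring.
  by move=> j; rewrite eq_sym.
rewrite -(bigID (fun p : 'I_N * 'I_N => p.1 == p.2) xpredT
  (fun p => f p.1 p.1 + f p.2 p.2)%R) /=.
rewrite -(pair_big xpredT xpredT (fun i j => f i i + f j j)%R) /=.
(* Each diagonal value is counted [N] times as a first index and [N] times as a second. *)
under eq_bigr do rewrite big_split /= sumr_const card_ord.
rewrite big_split /= sumr_const card_ord sumrMnl.
rewrite -mulr_natr -[X in (_ + X)%R]mulr_natr.
by ring.
Qed.

(** Treats the fixed-radius and the integrated kernels at once. The bound [C] makes every term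
    integrable, so [pair_sum_identity] can be integrated over configurations; one factor [N] comes
    from that identity, the other from [partition_expectation_sum]. *)
Lemma expectation_identity (k h : M -> M -> \bar R) (C : R) :
  measurable_fun setT (fun p : M * M => k p.1 p.2) ->
  (forall x y, `|k x y| <= C%:E) -> (forall x, 0 <= k x x) ->
  (forall x y, h x y = k x x + k y y - 2%:E * k x y) ->
  2%:E * partition_expectation V (lambda_sum k) +
    partition_expectation V (rhostar_sum h) =
  (N%:R ^+ 2)%:E * (2%:E * \int[mu]_x k x x).
Proof.
move=> mk kC k0 hE; have mO := measurable_Omega.
have kfin x y : k x y \is a fin_num.
  by rewrite fin_num_abs (le_lt_trans (kC x y)) // ltry.
have mkxx : measurable_fun setT (fun x => k x x).
  exact: (measurableT_comp mk (measurable_fun_pair (@measurable_id _ _ setT)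
    (@measurable_id _ _ setT))).
have ik i j : P.-integrable (Omega V) (fun X => k (tnth X i) (tnth X j)).
  apply: (@integrable_le_cst _ _ _ P _ _ C) => //.
  apply: measurable_funTS; exact: (measurableT_comp mk
    (measurable_fun_pair (measurable_tnth i) (measurable_tnth j))).
have ilam : P.-integrable (Omega V) (lambda_sum k).
  apply: integrableD => //; first exact: integrable_sum.
  by apply: integrable_sum.
have irho : P.-integrable (Omega V) (rhostar_sum h).
  apply: integrable_sum => // p _.
  (* Integrability of [h] is inherited from [k] through [hE]. *)
  rewrite (_ : (fun X => _) = (fun X : N.-tuple M =>
    k (tnth X p.1) (tnth X p.1) + k (tnth X p.2) (tnth X p.2) -
    2%:E * k (tnth X p.1) (tnth X p.2))); last by apply/funext => X; rewrite hE.
  apply: integrableB => //; first exact: integrableD.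
  exact: integrableZl.
rewrite /partition_expectation -/P -integralZl // -integralD //; last first.
  exact: integrableZl.
under eq_integral do rewrite (pair_sum_identity k h _ kfin hE).
rewrite integralZl //; last by apply: integrable_sum.
rewrite [X in _ * X](@partition_expectation_sum (fun x => k x x)) //.
rewrite !muleA -!EFinM; congr (_%:E * _); ring.
Qed.

End expectation.

Theorem theorem3p1 (R : realType) (d : measure_display)
    (M : measurableMetricType R d)
    (M_compact : compact [set: M]) (M_separable : separable_space M)
    (M_borel : borel_space M)
    (mu : probability M R) (xi : {finite_measure set R -> \bar R})
    (N : nat) (V : equal_measure_partition mu N) :
  (forall r : R, radii (M := M) r ->
     2%:E * partition_expectation V (lambda_sum (lambda_r mu r)) +
       partition_expectation V (rhostar_sum (rhostar_r mu r)) =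
     (N%:R ^+ 2)%:E * mean_rhostar_r mu r) /\
  2%:E * partition_expectation V (lambda_sum (lambda mu xi)) +
    partition_expectation V (rhostar_sum (rhostar mu xi)) =
  (N%:R ^+ 2)%:E * mean_rhostar mu xi.
Proof.
split=> [r _|].
  rewrite mean_rhostar_rE //; apply: (expectation_identity V _ _ 1%R).
  - exact: (measurableT_comp (measurable_lambda_r M_separable M_borel mu)
      (measurable_pair1 r)).
  - exact: abse_lambda_r_le1.
  - exact: lambda_r_ge0.
  - exact: rhostar_rE.
rewrite mean_rhostarE //.
(* The bound 1 on [lambda_r] becomes, after integration in the radius, the [xi]-mass of [radii]. *)
apply: (expectation_identity V _ _ (fine (xi (radii (M := M))))).
- exact: measurable_lambda.
- exact: abse_lambda_le.
- exact: lambda_ge0.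
- exact: rhostarE.
Qed.
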